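(* For every integer $n\ge 0$, $c_6(n)$ is odd if $n=(7j^2+5j)/2$ for some $j\in\mathbb{Z}$, and $c_6(n)$ is even otherwise.
   Context: A partition of $n\ge 0$ is a finite multiset of positive integers summing to $n$; the empty partition is the partition of $0$. For $n\ge 0$, $c_6(n)$ denotes the number of partitions $\lambda$ of $n$ such that either (a) the even parts of $\lambda$ are distinct and $1$ is the only odd integer that may be a part (with any multiplicity), or (b) there is an integer $j\ge 1$ such that each of $2,4,\dots,2j$ appears in $\lambda$ exactly twice, every even part greater than $2j$ is at least $4j+2$ and appears at most once, every odd part is at most $2j+1$, each odd part at most $2j-1$ appears at most once, and the part $2j+1$ may appear with any multiplicity. *)

(* Defs.v *)
From mathcomp Require Import all_boot all_order all_algebra.
Set Implicit Arguments. Unset Strict Implicit. Unset Printing Implicit Defensive.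

(* lam is a partition of n: positive parts summing to n, listed in
   nonincreasing order (canonical representative of the multiset). *)
Definition is_partition (n : nat) (lam : seq nat) : bool :=
  [&& sorted geq lam, all (fun x => 0 < x) lam & sumn lam == n].

Definition cond_a (lam : seq nat) : bool :=
  all (fun x => (~~ odd x ==> (count_mem x lam <= 1)) && (odd x ==> (x == 1))) lam.

Definition cond_b_j (lam : seq nat) (j : nat) : bool :=
  [&& 1 <= j,
      all (fun i => count_mem (2 * i) lam == 2) (iota 1 j) &
      all (fun x =>
             (~~ odd x && (2 * j < x) ==> (4 * j + 2 <= x) && (count_mem x lam <= 1))
          && (odd x ==> (x <= 2 * j + 1) && ((x <= 2 * j - 1) ==> (count_mem x lam <= 1))))
          lam].

(* Condition (b): some j >= 1 works.  Any such j satisfies 2 + 4 + ... + 2j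
   twice <= sumn lam, hence j <= sumn lam, so bounding the search is harmless. *)
Definition cond_b (lam : seq nat) : bool :=
  has (cond_b_j lam) (iota 1 (sumn lam)).

(* Every partition of n has at most n parts, each at most n: it is encoded
   by a nonincreasing n-tuple over {0..n} padded with zeros. *)
Definition parts_of (n : nat) (t : n.-tuple 'I_n.+1) : seq nat :=
  filter (fun x => 0 < x) (map val t).

Definition c6 (n : nat) : nat :=
  #|[set t : n.-tuple 'I_n.+1 |
      sorted geq (map val t) && is_partition n (parts_of t)
      && (cond_a (parts_of t) || cond_b (parts_of t))]|.

(* Main.v *)
Require Import Defs.
From mathcomp Require Import all_boot all_order all_algebra.
From mathcomp Require Import ring zify.
Set Implicit Arguments. Unset Strict Implicit. Unset Printing Implicit Defensive.
Import GRing.Theory Num.Theory.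

(** Condition (a) is the case [j = 0] of condition (b), and the conditions for
    different [j] exclude each other, so [c6] has the generating function
    [sum_j q^(2j(j+1)) (-q;q^2)_j (-q^(4j+2);q^2)_oo / (1 - q^(2j+1))].
    Modulo 2, [1 + q^(4j+2)] is the square of [1 - q^(2j+1)], hence this is
    [sum_j q^(2j(j+1)) (q;q^2)_(j+1) (q^(4j+4);q^2)_oo], the left-hand side of the
    third Rogers-Selberg identity modulo 2. It is evaluated by Bailey's method:
    [(q;q^2)_(j+1) = sum_r (-1)^r q^(r(3r+1)/2) [2j+1, j-r]_(q^2)], and for fixed
    [r] the sum over [j] is [q^(2r(r+1))]; the exponents add up to
    [(7r^2+5r)/2]. All series are handled as polynomials modulo a power of ['X]. *)

(** * Partitions as multiplicity functions *)

Lemma sumn_count_mem M (s : seq nat) :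
  all (fun x => 0 < x <= M) s -> sumn s = \sum_(x < M) x.+1 * count_mem x.+1 s.
Proof.
elim: s => [|y s IH] /=; first by rewrite big1 // => i _; rewrite muln0.
case/andP=> /andP [y0 yM] /IH ->.
rewrite (eq_bigr (fun x : 'I_M => x.+1 * (y == x.+1) + x.+1 * count_mem x.+1 s)); last first.
  by move=> x _; rewrite mulnDr.
rewrite [RHS]big_split /=; congr (_ + _).
have lt_y : y.-1 < M by lia.
rewrite (bigD1 (Ordinal lt_y)) //= prednK // eqxx muln1 big1 ?addn0 //.
move=> i ne; case: eqP => [e|]; rewrite ?muln0 //.
by case/eqP: ne; apply: val_inj => /=; rewrite e.
Qed.

Lemma size_le_sumn (s : seq nat) : all (fun x => 0 < x) s -> size s <= sumn s.
Proof. by elim: s => //= x s IH /andP [x0 /IH]; lia. Qed.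

Lemma mem_le_sumn (s : seq nat) x : x \in s -> x <= sumn s.
Proof.
elim: s => //= y s IH; rewrite inE => /orP [/eqP -> |/IH]; lia.
Qed.

Lemma sorted_geq_eq (s t : seq nat) :
  sorted geq s -> sorted geq t -> perm_eq s t -> s = t.
Proof.
apply: sorted_eq => [x y z|x y]; first by rewrite /geq /= => ? ?; lia.
by rewrite /geq /=; lia.
Qed.

Lemma count_mem0 (s : seq nat) : count_mem 0 s = size s - size (filter (fun x => 0 < x) s).
Proof.
rewrite size_filter -(count_predC (fun x => 0 < x)) addKn.
by apply: eq_count => x /=; case: x.
Qed.

Definition partition_tuple n (t : n.-tuple 'I_n.+1) : bool :=
  sorted geq (map val t) && is_partition n (parts_of t).

(** [M] bounds both the parts and the multiplicities and is kept apart from [n], so that it can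
    later be chosen to fit the product. For [n <= M] the [inord] is harmless: a partition of [n] has
    at most [n] parts. *)
Definition mult_fun n M (t : n.-tuple 'I_n.+1) : {ffun 'I_M -> 'I_M.+1} :=
  [ffun x : 'I_M => inord (count_mem x.+1 (parts_of t))].

Lemma parts_of_bound n (t : n.-tuple 'I_n.+1) : all (fun x => 0 < x <= n) (parts_of t).
Proof.
apply/allP => x; rewrite mem_filter => /andP [-> /mapP [y _ ->]] /=.
by rewrite -ltnS ltn_ord.
Qed.

Lemma mult_funE n M (t : n.-tuple 'I_n.+1) (x : 'I_M) :
  n <= M -> mult_fun M t x = count_mem x.+1 (parts_of t) :> nat.
Proof.
move=> nM; rewrite ffunE inordK // ltnS (leq_trans _ nM) //.
apply: leq_trans (count_size _ _) _.
by rewrite size_filter (leq_trans (count_size _ _)) // size_map size_tuple.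
Qed.

Lemma mult_fun_inj n M : n <= M -> {in @partition_tuple n &, injective (mult_fun (n := n) M)}.
Proof.
move=> nM t u /andP [st _] /andP [su _] e.
have ec x : 0 < x -> count_mem x (parts_of t) = count_mem x (parts_of u).
  case: x => // x _; case: (ltnP x M) => [lt_x|le_M].
    by rewrite -!(mult_funE _ (Ordinal lt_x) nM) e.
  rewrite !(count_memPn _) //; apply/negP => /(allP (parts_of_bound _)); lia.
have pp : perm_eq (parts_of t) (parts_of u).
  apply/allP => x _ /=; apply/eqP; case: x => [|x]; last exact: ec.
  by rewrite !(count_memPn _) //; apply/negP => /(allP (parts_of_bound _)).
apply/val_inj/(inj_map val_inj) => /=; apply: sorted_geq_eq => //.
apply/allP => x _ /=; apply/eqP; case: x => [|x].
  (* The padding zeros agree too: both tuples have length [n] and the same number of positive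
     entries. *)
  by rewrite !count_mem0 -/(parts_of t) -/(parts_of u) (perm_size pp) !size_map !size_tuple.
have := ec x.+1 isT; rewrite /parts_of !count_filter.
have ep : predI (pred1 x.+1) (fun y => 0 < y) =1 pred1 x.+1.
  by move=> y /=; case: eqP => // ->.
by rewrite !(eq_count ep).
Qed.

Lemma mult_fun_surj n M (f : {ffun 'I_M -> 'I_M.+1}) :
  n <= M -> \sum_(x < M) x.+1 * f x = n -> exists2 t, partition_tuple t & mult_fun (n := n) M t = f.
Proof.
move=> nM ef.
pose L := flatten [seq nseq (f x) x.+1 | x : 'I_M].
have L_bound : all (fun x => 0 < x <= M) L.
  apply/allP => y /flattenP [s /mapP [x _ ->]]; rewrite mem_nseq => /andP [_ /eqP ->].
  exact: ltn_ord.
have L_pos : all (fun x => 0 < x) L by apply: sub_all L_bound => x /andP [].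
have L_count (x : 'I_M) : count_mem x.+1 L = f x.
  rewrite /L count_flatten -map_comp sumnE big_map big_enum /=.
  rewrite (bigD1 x) //= count_nseq /= eqxx mul1n big1 ?addn0 // => y ne.
  by rewrite count_nseq /= eqSS (negbTE (_ : _ != _ :> nat)).
have L_sum : sumn L = n.
  by rewrite (sumn_count_mem L_bound) -ef; apply: eq_bigr => x _; rewrite L_count.
have L_size : size L <= n by rewrite -L_sum size_le_sumn.
(* The padding fits: positive parts with sum [n] number at most [n]. *)
pose s := sort geq (L ++ nseq (n - size L) 0).
have s_size : size s == n by rewrite size_sort size_cat size_nseq subnKC.
have s_le x : x \in s -> x < n.+1.
  rewrite mem_sort mem_cat mem_nseq => /orP [/mem_le_sumn|/andP [_ /eqP ->] //].
  by rewrite L_sum.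
have t_size : size (map (@inord n) s) == n by rewrite size_map.
pose t := Tuple t_size.
have t_val : map val t = s.
  rewrite /= -map_comp -[RHS]map_id; apply/eq_in_map => x xs /=.
  by rewrite inordK // s_le.
have s_sorted : sorted geq s by apply: sort_sorted => x y; rewrite /geq /=; lia.
have t_perm : perm_eq (parts_of t) L.
  rewrite /parts_of t_val (perm_trans (perm_filter _ (permEl (perm_sort _ _)))) //.
  rewrite filter_cat (all_filterP L_pos) -[X in perm_eq _ X]cats0 perm_cat2l.
  by rewrite (_ : [seq x <- nseq _ 0 | 0 < x] = [::]) //; elim: (n - size L).
exists t.
  rewrite /partition_tuple t_val s_sorted /is_partition (perm_all _ t_perm) L_pos.
  rewrite (perm_sumn t_perm) L_sum eqxx /parts_of t_val sorted_filter //.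
  by move=> x y z; rewrite /geq /=; lia.
apply/ffunP => x; apply: val_inj; rewrite /= mult_funE //.
by rewrite (permP t_perm) L_count.
Qed.

(** [S] restricts each multiplicity separately; this is what makes the generating function a product
    over the parts. *)
Lemma card_partition_tuple n M (S : nat -> nat -> bool) : n <= M ->
  #|[set t : n.-tuple 'I_n.+1 | partition_tuple t &&
      [forall x : 'I_M, S x.+1 (count_mem x.+1 (parts_of t))]]| =
  #|[set f : {ffun 'I_M -> 'I_M.+1} | (\sum_(x < M) x.+1 * f x == n) &&
      [forall x : 'I_M, S x.+1 (f x)]]|.
Proof.
move=> nM; set A := [set t | _]; set B := [set f | _].
have injA : {in A &, injective (mult_fun (n := n) M)}.
  move=> t u; rewrite !inE => /andP [pt _] /andP [pu _].
  exact: mult_fun_inj.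
rewrite -(card_in_imset injA); apply: eq_card => f; apply/imsetP/idP.
  case=> t; rewrite inE => /andP [pt St] ->; rewrite inE.
  rewrite (eq_bigr (fun x : 'I_M => x.+1 * count_mem x.+1 (parts_of t))); last first.
    by move=> x _; rewrite mult_funE.
  rewrite -sumn_count_mem; last first.
    apply: sub_all (parts_of_bound t) => x /andP [-> /= le_x].
    exact: leq_trans nM.
  case/andP: pt => _ /and3P [_ _ ->] /=.
  by apply/forallP => x; rewrite mult_funE // (forallP St).
rewrite inE => /andP [/eqP ef /forallP Sf].
have [t pt et] := mult_fun_surj nM ef; exists t => //.
by rewrite inE pt; apply/forallP => x; rewrite -mult_funE // et.
Qed.

(** * Conditions (a) and (b) as constraints on single parts *)

(* The multiplicities [m] that condition (b) with parameter [j] allows for the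
   part [x > 0]; at [j = 0] this is condition (a), because [2 * j - 1] truncates
   to [0]. *)
Definition mult_ok (j x m : nat) : bool :=
  if odd x then (m == 0) || (x <= 2 * j + 1) && ((x <= 2 * j - 1) ==> (m <= 1))
  else if x <= 2 * j then m == 2 else (m == 0) || (4 * j + 2 <= x) && (m <= 1).

Definition cond_j (lam : seq nat) (j : nat) : bool :=
  if j is 0 then cond_a lam else cond_b_j lam j.

Lemma cond_jP (lam : seq nat) (j : nat) : all (fun x => 0 < x) lam ->
  reflect (forall x, 0 < x -> mult_ok j x (count_mem x lam)) (cond_j lam j).
Proof.
move=> /allP pos; case: j => [|j].
  apply: (iffP allP) => [H x x0|H x xs].
    rewrite /mult_ok.
    case: (boolP (x \in lam)) => [/H|/count_memPn ->] /=; case: (boolP (odd x)) => ox //=; last first.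
    - by case: ifP => //; lia.
    - by case: ifP => [|_]; lia.
    - by move=> /eqP ->; rewrite orbC.
  have := H x (pos x xs); rewrite /mult_ok.
  have : 0 < count_mem x lam by rewrite -has_count has_pred1.
  by have := pos x xs; case: (odd x) => /=; [|case: ifP]; lia.
apply: (iffP and3P) => [[_ /allP H2 /allP H] x x0|H].
  rewrite /mult_ok.
  have c0 : x \notin lam -> count_mem x lam = 0 by move/count_memPn.
  case: (boolP (odd x)) => [ox|ex].
    case: (boolP (x \in lam)) => [/H|/c0 -> //]; rewrite ox /=; lia.
  case: ifP => [le_x|nle].
    have ex2 : x = 2 * x./2 by rewrite -{1}(odd_double_half x) (negbTE ex); lia.
    rewrite ex2; apply: H2; rewrite mem_iota; lia.
  case: (boolP (x \in lam)) => [/H|/c0 -> //]; rewrite ex /=; lia.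
split=> //; apply/allP => x.
  rewrite mem_iota => bx; have := H (2 * x); rewrite /mult_ok oddM /=.
  have -> : 2 * x <= 2 * j.+1 by lia.
  by apply; lia.
move=> xs; have := H x (pos x xs); rewrite /mult_ok.
have : 0 < count_mem x lam by rewrite -has_count has_pred1.
by case: (odd x) => /=; [|case: ifP]; lia.
Qed.

(** If [j < k], the part [2 * j.+1] must occur exactly twice for [k], but at most once for [j]. *)
Lemma cond_j_uniq (lam : seq nat) (j k : nat) : all (fun x => 0 < x) lam ->
  cond_j lam j -> cond_j lam k -> j = k.
Proof.
move=> pos; wlog le_jk : j k / j <= k.
  by move=> W; case: (leqP j k) => [|/ltnW] le cj ck; [|symmetry]; apply: W.
move=> /(cond_jP _ pos) cj /(cond_jP _ pos) ck.
case: (ltngtP j k) le_jk => // lt_jk _.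
have := cj (2 * j.+1); have := ck (2 * j.+1); rewrite /mult_ok oddM /=.
have -> : 2 * j.+1 <= 2 * k by lia.
have -> : 2 * j.+1 <= 2 * j = false by lia.
by lia.
Qed.

Lemma c6E n : c6 n = \sum_(j < n.+1)
  #|[set t : n.-tuple 'I_n.+1 | partition_tuple t && cond_j (parts_of t) j]|.
Proof.
under eq_bigr => j _ do rewrite -sum1_card big_mkcond.
rewrite exchange_big /c6 -sum1_card big_mkcond; apply: eq_bigr => t _ /=.
rewrite in_set -/(partition_tuple t).
under eq_bigr => j _ do rewrite in_set.
case: (boolP (partition_tuple t)) => [pt|_] /=; last by rewrite big1.
have [_ /and3P [_ pos /eqP sum_t]] := andP pt.
have -> : cond_a (parts_of t) || cond_b (parts_of t) =
          [exists j : 'I_n.+1, cond_j (parts_of t) j].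
  rewrite /cond_b sum_t; apply/orP/existsP => [[ca|/hasP [j]]|[[[|j] lt_j] cj]].
  - by exists ord0.
  - rewrite mem_iota => bj cj; have lt_j : j < n.+1 by lia.
    by exists (Ordinal lt_j); case: j bj cj lt_j.
  - by left.
  - by right; apply/hasP; exists j.+1; rewrite // mem_iota; lia.
case: existsP => [[j cj]|H]; last first.
  by rewrite big1 // => j _; case: ifP => // cj; case: H; exists j.
rewrite (bigD1 j) //= cj big1 ?addn0 // => k ne; case: ifP => // ck.
by case/eqP: ne; apply: val_inj; apply: cond_j_uniq cj.
Qed.

(** Parts beyond the bound 4n+2 have multiplicity 0, which is allowed since the even parts required
    twice are at most 2j <= 2n. The bound is even, so that it covers 2n+1 odd and 2n+1 even
    parts. *)
Lemma card_cond_j n j : j <= n ->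
  #|[set t : n.-tuple 'I_n.+1 | partition_tuple t && cond_j (parts_of t) j]| =
  #|[set t : n.-tuple 'I_n.+1 | partition_tuple t &&
     [forall x : 'I_(n.*2.+1.*2), mult_ok j x.+1 (count_mem x.+1 (parts_of t))]]|.
Proof.
move=> le_jn; apply: eq_card => t; rewrite !in_set.
case: (boolP (partition_tuple t)) => //= pt.
have [_ /and3P [_ pos _]] := andP pt.
apply/(cond_jP _ pos)/forallP => [H x|H x x0]; first exact: H.
case: (ltnP x.-1 n.*2.+1.*2) => [lt_x|le_x].
  by have := H (Ordinal lt_x); rewrite /= prednK.
rewrite (count_memPn _); last first.
  by apply/negP => /(allP (parts_of_bound t)); lia.
by rewrite /mult_ok; case: ifP => // _; case: ifP => //; lia.
Qed.

Local Open Scope ring_scope.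

Lemma coef_mult_prod (R : comNzRingType) n M (S : nat -> nat -> bool) :
  (\prod_(x < M) \sum_(m < M.+1 | S x.+1 m) ('X^(x.+1 * m) : {poly R}))`_n =
  #|[set f : {ffun 'I_M -> 'I_M.+1} | (\sum_(x < M) x.+1 * f x == n)%N &&
      [forall x : 'I_M, S x.+1 (f x)]]|%:R.
Proof.
rewrite bigA_distr_big_dep coef_sum -sum1_card natr_sum /=.
rewrite [LHS]big_mkcond [RHS]big_mkcond /=; apply: eq_bigr => f _.
rewrite prodrXr coefXn in_set eq_sym.
rewrite (_ : (f \in family _) = [forall x : 'I_M, S x.+1 (f x)]) //.
by case: [forall x, _]; rewrite ?andbT ?andbF //=; case: eqP.
Qed.

(** * Gaussian binomials in characteristic 2 *)

(** The Gaussian binomial, defined by a q-Pascal rule to avoid division. *)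
Fixpoint qbinom (R : comNzRingType) (q : R) (n k : nat) : R :=
  match n, k with
  | _, 0 => 1
  | 0, _.+1 => 0
  | n'.+1, k'.+1 => qbinom q n' k'.+1 + q ^+ (n' - k') * qbinom q n' k'
  end.

(** This is (-a;q)_n, which in characteristic 2 is also (a;q)_n. *)
Definition qpoch (R : comNzRingType) (a q : R) (n : nat) : R :=
  \prod_(i < n) (1 + a * q ^+ i).

Lemma qbinom0 (R : comNzRingType) (q : R) n : qbinom q n 0 = 1.
Proof. by case: n. Qed.

Lemma qbinomS (R : comNzRingType) (q : R) n k :
  qbinom q n.+1 k.+1 = qbinom q n k.+1 + q ^+ (n - k) * qbinom q n k.
Proof. by []. Qed.

Lemma qbinom_small (R : comNzRingType) (q : R) n k : (n < k)%N -> qbinom q n k = 0.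
Proof.
elim: n k => [|n IH] [|k] //= lt_nk.
by rewrite !IH ?mulr0 ?addr0 //; lia.
Qed.

Lemma qbinomn (R : comNzRingType) (q : R) n : qbinom q n n = 1.
Proof. by elim: n => //= n ->; rewrite qbinom_small // subnn expr0 mul1r add0r. Qed.

(** The second q-Pascal rule: expanding with the first rule and the induction hypothesis brings both
    sides to the same combination. The cases on [k] against [n] are due to truncated subtraction. *)
Lemma qbinomS' (R : comNzRingType) (q : R) n k :
  qbinom q n.+1 k.+1 = qbinom q n k + q ^+ k.+1 * qbinom q n k.+1.
Proof.
elim: n k => [|n IH] k.
  by case: k => [|k] /=; rewrite ?mulr0 ?mulr1 ?addr0 ?add0r ?expr0.
case: k => [|k].
  rewrite qbinomS [in LHS]IH qbinomS !qbinom0 !subn0 !mulr1 mulrDr -exprD.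
  by rewrite add1n addrA.
case: (ltnP n k) => [lt_nk|le_kn].
  rewrite qbinomS !(@qbinom_small _ q n.+1 k.+2) ?mulr0 ?addr0 ?add0r; try lia.
  case: (ltnP n.+1 k.+1) => lt2; first by rewrite (qbinom_small _ lt2) mulr0.
  have -> : (n.+1 - k.+1 = 0)%N by lia.
  by rewrite mul1r.
rewrite qbinomS [in LHS]IH [in X in _ + X]IH.
rewrite [qbinom q n.+1 k.+1 in RHS]qbinomS [qbinom q n.+1 k.+2 in RHS]qbinomS.
case: (ltnP n k.+1) => [lt|le].
  have -> : k = n by lia.
  rewrite !(@qbinom_small _ q n n.+1) ?(@qbinom_small _ q n n.+2) // !subnn ?subSnn.
  by ring.
have [m ->] : exists m, n = (m + k.+1)%N by exists (n - k.+1)%N; lia.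
have -> : ((m + k.+1).+1 - k.+1 = m.+1)%N by lia.
have -> : (m + k.+1 - k = m.+1)%N by lia.
have -> : (m + k.+1 - k.+1 = m)%N by lia.
rewrite !exprS; ring.
Qed.

Lemma qbinom_sym (R : comNzRingType) (q : R) n k :
  (k <= n)%N -> qbinom q n (n - k) = qbinom q n k.
Proof.
elim: n k => [|n IH] [|k] le_kn //; first by rewrite subn0 qbinomn qbinom0.
rewrite subSS qbinomS'; move: le_kn; rewrite ltnS leq_eqVlt.
case/orP => [/eqP ->|lt_kn].
  by rewrite subnn qbinom0 qbinomn qbinom_small // mulr0 addr0.
have e : (n - k = (n - k.+1).+1)%N by lia.
rewrite e qbinomS -e IH ?(ltnW lt_kn) // IH //.
by rewrite (_ : n - (n - k.+1) = k.+1)%N //; lia.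
Qed.

Lemma qpochS (R : comNzRingType) (a q : R) n :
  qpoch a q n.+1 = qpoch a q n * (1 + a * q ^+ n).
Proof. by rewrite /qpoch big_ord_recr. Qed.

Lemma qpochD (R : comNzRingType) (a q : R) m n :
  qpoch a q (m + n) = qpoch a q m * qpoch (a * q ^+ m) q n.
Proof.
elim: n => [|n IH]; first by rewrite addn0 /qpoch big_ord0 mulr1.
by rewrite addnS !qpochS IH -!mulrA -exprD.
Qed.

Lemma qbinom_qpoch (R : comNzRingType) (q : R) (ch2 : 2%N \in [pchar R]) m k :
  qbinom q (m + k) k * qpoch q q m * qpoch q q k = qpoch q q (m + k).
Proof.
elim: m k => [|m IHm] k.
  by rewrite add0n qbinomn mul1r /qpoch big_ord0 mul1r.
elim: k => [|k IHk]; first by rewrite addn0 qbinom0 mul1r /qpoch big_ord0 mulr1.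
rewrite addnS qbinomS (_ : m.+1 + k - k = m.+1)%N; last by lia.
have e1 := IHm k.+1; rewrite addnS -addSn in e1.
rewrite mulrDl mulrDl {1}(qpochS q q m) {2}(qpochS q q k) [in RHS]qpochS.
rewrite [X in X + _](_ : _ = qpoch q q (m.+1 + k) * (1 + q * q ^+ m)); last by rewrite -e1; ring.
rewrite [X in _ + X](_ : _ = qpoch q q (m.+1 + k) * (q * q ^+ m * (1 + q * q ^+ k))); last first.
  by rewrite -IHk exprS; ring.
(* The two terms contribute 1 + q^(m+1) and q^(m+1) + q^(m+k+2); the doubled q^(m+1) vanishes. *)
have := addrr_pchar2 ch2 (q * q ^+ m * qpoch q q (m.+1 + k)).
rewrite addSn !exprS exprD => z.
by rewrite -[RHS]addr0 -z; ring.
Qed.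

(* The limiting case of the q-Chu-Vandermonde sum behind the finite form of
   Bailey's lemma. Induction on [n]: the q-Pascal rule splits the sum into
   [(1 + z q^(n+1))] times itself plus [z q^(n+1)] times its value at [z q]. *)
Lemma qvandermonde_limit (R : comNzRingType) (q z : R) (ch2 : 2%N \in [pchar R]) n :
  \sum_(i < n.+1) z ^+ i * q ^+ (i * i) * qbinom q n i * qpoch (z * q ^+ i.+1) q (n - i)
  = 1.
Proof.
elim: n z => [|n IH] z.
  by rewrite big_ord1 /= /qpoch big_ord0 muln0 !expr0 !mulr1.
have split_term (i : 'I_n.+2) :
  z ^+ i * q ^+ (i * i) * qbinom q n.+1 i * qpoch (z * q ^+ i.+1) q (n.+1 - i) =
  z ^+ i * q ^+ (i * i) * qbinom q n i * qpoch (z * q ^+ i.+1) q (n.+1 - i) +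
  (if val i is k.+1 then
     z ^+ i * q ^+ (i * i) * (q ^+ (n - k) * qbinom q n k)
     * qpoch (z * q ^+ i.+1) q (n.+1 - i) else 0).
  by case: i => [[|i] lt_i]; rewrite ?qbinomS ?qbinom0 ?addr0 //=; ring.
rewrite (eq_bigr _ (fun i _ => split_term i)) big_split /=.
rewrite big_ord_recr /= qbinom_small // mulr0 mul0r addr0.
rewrite (eq_bigr (fun i : 'I_n.+1 => (z ^+ i * q ^+ (i * i) * qbinom q n i *
  qpoch (z * q ^+ i.+1) q (n - i)) * (1 + z * q ^+ n.+1))); last first.
  move=> [i lt_i] _ /=; rewrite subSn // qpochS -!mulrA -exprD.
  by rewrite (_ : i.+1 + (n - i) = n.+1)%N //; lia.
rewrite -big_distrl /= IH mul1r big_ord_recl /= add0r.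
rewrite (eq_bigr (fun i : 'I_n.+1 => z * q ^+ n.+1 * ((z * q) ^+ i * q ^+ (i * i) * qbinom q n i *
  qpoch (z * q * q ^+ i.+1) q (n - i)))); last first.
  move=> [i lt_i] _ /=; rewrite /bump /= add1n subSS exprMn.
  rewrite (_ : z * q * q ^+ i.+1 = z * q ^+ i.+2); last by rewrite -mulrA -exprS.
  rewrite (_ : q ^+ n.+1 = q * (q ^+ i * q ^+ (n - i))); last by rewrite -exprD -exprS; congr (_ ^+ _); lia.
  rewrite (_ : i.+1 * i.+1 = i * i + i + i + 1)%N; last by lia.
  by rewrite !exprD exprS expr1; ring.
rewrite -big_distrr /= IH mulr1 -addrA addrr_pchar2 ?addr0 //.
Qed.

Arguments qbinom : simpl never.

(** * Finite expansion of (q;q^2)_(n+1) with exponents r(3r+1)/2 *)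

(* [pent r = r (3 r + 1) / 2]. *)
Definition pent (r : int) : nat :=
  match r with
  | Posz d => d * d + 'C(d.+1, 2)
  | Negz d => d.+1 * d.+1 + 'C(d.+1, 2)
  end.

Lemma pentE r : ((pent r)%:Z * 2 = r * (3 * r + 1))%R.
Proof.
have bin2E d : ('C(d.+1, 2) * 2 = d.+1 * d)%N.
  by rewrite bin2 /= muln2 halfK oddM /=; case: (odd d) => /=; lia.
case: r => d; rewrite /pent; have := bin2E d; set c := 'C(_, _); clearbody c; lia.
Qed.

Arguments pent : simpl never.

(** The reflection has no fixed point on a range of even length, so equal terms cancel in pairs. *)
Lemma big_ord_sym_pchar2 (R : comNzRingType) (ch2 : 2%N \in [pchar R]) (f : nat -> R) n :
  (forall k, (k < n.*2)%N -> f (n.*2.-1 - k)%N = f k) -> \sum_(k < n.*2) f k = 0.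
Proof.
move=> sym; rewrite -addnn big_split_ord /=.
rewrite [X in _ + X](reindex_inj rev_ord_inj) /= -big_split big1 //= => k _.
rewrite -[f k]sym; last by have := ltn_ord k; lia.
rewrite (_ : n.*2.-1 - k = n + (n - k.+1))%N ?addrr_pchar2 //.
by have := ltn_ord k; lia.
Qed.

(** A bilateral sum over r = c - k; for m = 2c+1 the index r runs from -c-1 to c. *)
Definition pent_sum (R : comNzRingType) (q : R) (c m : nat) : R :=
  \sum_(k < m.+1) q ^+ pent (c%:Z - k%:Z) * qbinom (q ^+ 2) m k.

(** In the first q-Pascal rule, one half is the sum for 2n itself; the other, read backwards, is the
    same sum with every exponent raised by 2n+1. *)
Lemma pent_sum_odd (R : comNzRingType) (q : R) n :
  pent_sum q n n.*2.+1 = (1 + q ^+ n.*2.+1) * pent_sum q n n.*2.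
Proof.
have split_term (k : 'I_n.*2.+2) :
  q ^+ pent (n%:Z - k%:Z) * qbinom (q ^+ 2) n.*2.+1 k =
  q ^+ pent (n%:Z - k%:Z) * qbinom (q ^+ 2) n.*2 k +
  (if val k is i.+1 then q ^+ pent (n%:Z - k%:Z) *
     ((q ^+ 2) ^+ (n.*2 - i) * qbinom (q ^+ 2) n.*2 i) else 0).
  by case: k => [[|k] lt_k]; rewrite ?qbinomS ?qbinom0 ?addr0 ?mulrDr.
rewrite /pent_sum (eq_bigr _ (fun i _ => split_term i)) big_split /= mulrDl mul1r.
congr (_ + _); first by rewrite big_ord_recr /= qbinom_small // mulr0 addr0.
rewrite big_ord_recl /= add0r big_distrr /= [RHS](reindex_inj rev_ord_inj) /=.
apply: eq_bigr => -[i lt_i] _ /=; rewrite /bump /= add1n subSS.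
rewrite qbinom_sym // !mulrA -exprM -!exprD; congr (q ^+ _ * _).
have [x ex] : exists x, x = n%:Z - i%:Z by exists (n%:Z - i%:Z).
rewrite (_ : n%:Z - i.+1%:Z = x - 1); last by lia.
rewrite (_ : n%:Z - (n.*2 - i)%N%:Z = - x); last by lia.
by have := pentE (x - 1); have := pentE (- x); lia.
Qed.

(* The other half of the q-Pascal rule gives terms symmetric under
   [r |-> - 1 - r], which cancel in pairs. *)
Lemma pent_sum_even (R : comNzRingType) (ch2 : 2%N \in [pchar R]) (q : R) n :
  pent_sum q n.+1 n.+1.*2 = pent_sum q n n.*2.+1.
Proof.
have split_term (k : 'I_n.*2.+3) :
  q ^+ pent (n.+1%:Z - k%:Z) * qbinom (q ^+ 2) n.*2.+2 k =
  q ^+ pent (n.+1%:Z - k%:Z) * ((q ^+ 2) ^+ k * qbinom (q ^+ 2) n.*2.+1 k) +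
  (if val k is i.+1 then q ^+ pent (n.+1%:Z - k%:Z) * qbinom (q ^+ 2) n.*2.+1 i
   else 0).
  case: k => [[|k] lt_k]; first by rewrite !qbinom0 /= expr0 !mulr1 [RHS]addr0.
  by rewrite qbinomS' mulrDr addrC.
rewrite /pent_sum doubleS (eq_bigr _ (fun i _ => split_term i)) big_split /=.
rewrite big_ord_recr /= qbinom_small // !mulr0 addr0.
rewrite -[n.*2.+2]/(n.+1.*2) (big_ord_sym_pchar2 ch2 (f := fun k =>
  q ^+ pent (n.+1%:Z - k%:Z) * ((q ^+ 2) ^+ k * qbinom (q ^+ 2) n.*2.+1 k))); last first.
  move=> k lt_k /=; rewrite qbinom_sym; last by lia.
  rewrite !mulrA -!exprM -!exprD; congr (q ^+ _ * _).
  have [x ex] : exists x, x = n%:Z - k%:Z by exists (n%:Z - k%:Z).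
  rewrite (_ : n.+1%:Z - k%:Z = x + 1); last by lia.
  rewrite (_ : n.+1%:Z - (n.+1.*2.-1 - k)%N%:Z = - x); last by lia.
  by have := pentE (x + 1); have := pentE (- x); lia.
rewrite add0r big_ord_recl /= add0r; apply: eq_bigr => i _.
by rewrite /bump /= add1n; congr (q ^+ pent _ * _); lia.
Qed.

Lemma pent_sumE (R : comNzRingType) (ch2 : 2%N \in [pchar R]) (q : R) n :
  pent_sum q n n.*2.+1 = \prod_(i < n.+1) (1 + q ^+ i.*2.+1).
Proof.
elim: n => [|n IH].
  rewrite /pent_sum big_ord_recr !big_ord1 /=.
  by rewrite qbinom0 qbinomn !mulr1.
by rewrite pent_sum_odd pent_sum_even // IH mulrC [RHS]big_ord_recr.
Qed.

(** The indices r and -1-r carry the same binomial by symmetry, so the sum folds onto r >= 0. *)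
Lemma pent_sum_fold (R : comNzRingType) (q : R) n :
  pent_sum q n n.*2.+1 =
  \sum_(r < n.+1) (q ^+ pent r%:Z + q ^+ pent (Negz r)) * qbinom (q ^+ 2) n.*2.+1 (n - r).
Proof.
rewrite /pent_sum -[n.*2.+2]/(n.+1.*2) -addnn big_split_ord /=.
rewrite [X in X + _](reindex_inj rev_ord_inj) -big_split /=.
apply: eq_bigr => -[r lt_r] _ /=; rewrite subSS mulrDl; congr (_ + _).
  by congr (q ^+ pent _ * _); lia.
rewrite -(@qbinom_sym _ _ n.*2.+1 (n - r)); last by lia.
by congr (q ^+ pent _ * qbinom _ _ _); lia.
Qed.

(** * The Rogers-Selberg identity modulo 2 *)

Definition eqmodX (F : fieldType) (n : nat) (p q : {poly F}) : Prop :=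
  'X^n %| p - q.

Lemma eqmodX_refl (F : fieldType) n (p : {poly F}) : eqmodX n p p.
Proof. by rewrite /eqmodX subrr dvdp0. Qed.

Lemma eqmodX_sym (F : fieldType) n (p q : {poly F}) : eqmodX n p q -> eqmodX n q p.
Proof. by rewrite /eqmodX -opprB dvdpNr. Qed.

Lemma eqmodX_trans (F : fieldType) n (p q r : {poly F}) :
  eqmodX n p q -> eqmodX n q r -> eqmodX n p r.
Proof. by move=> pq qr; rewrite /eqmodX -(subrKA q) dvdp_add. Qed.

Lemma eqmodX_sum (F : fieldType) n m (f g : 'I_m -> {poly F}) :
  (forall i, eqmodX n (f i) (g i)) -> eqmodX n (\sum_i f i) (\sum_i g i).
Proof.
move=> fg; rewrite /eqmodX -sumrB.
apply: (big_ind (fun p => 'X^n %| p)) => [|p r dp dr|i _]; first exact: dvdp0.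
  exact: dvdp_add.
exact: fg.
Qed.

Lemma eqmodX_mul2l (F : fieldType) n (a p q : {poly F}) :
  eqmodX n p q -> eqmodX n (a * p) (a * q).
Proof. by rewrite /eqmodX -mulrBr => /dvdp_mull; apply. Qed.

Lemma eqmodX_Xmul (F : fieldType) n m (p q : {poly F}) :
  eqmodX (n - m) p q -> eqmodX n ('X^m * p) ('X^m * q).
Proof.
rewrite /eqmodX -mulrBr => dpq; apply: (@dvdp_trans _ ('X^m * 'X^(n - m))).
  by rewrite -exprD dvdp_exp2l // -leq_subLR.
by rewrite dvdp_mul2l // expf_neq0 // polyX_eq0.
Qed.

(** A polynomial with nonzero constant term is coprime to ['X^n]. *)
Lemma eqmodX_cancel (F : fieldType) n (d p q : {poly F}) :
  d`_0 != 0 -> eqmodX n (d * p) (d * q) -> eqmodX n p q.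
Proof.
move=> d0; rewrite /eqmodX -mulrBr Gauss_dvdpr // coprimep_expl //.
by rewrite coprimep_sym coprimepX /root horner_coef0.
Qed.

Lemma eqmodX_coef (F : fieldType) n (p q : {poly F}) i :
  (i < n)%N -> eqmodX n p q -> p`_i = q`_i.
Proof.
move=> lt_in /dvdpP [r er]; apply/eqP; rewrite -subr_eq0 -coefB er.
by rewrite coefMXn lt_in.
Qed.

Lemma eqmodX_qpoch (F : fieldType) n e m (a : {poly F}) :
  (n <= e)%N -> eqmodX n (a * qpoch 'X^e ('X^2) m) a.
Proof.
move=> le_ne; rewrite -[X in eqmodX _ _ X]mulr1; apply: eqmodX_mul2l.
elim: m => [|m IH]; first by rewrite /qpoch big_ord0; apply: eqmodX_refl.
apply: eqmodX_trans IH; rewrite qpochS mulrDr mulr1 /eqmodX addrAC subrr add0r.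
by rewrite dvdp_mull // dvdp_mulr // dvdp_exp2l.
Qed.

Lemma qpochX_coef0 (F : fieldType) m : (qpoch ('X^2 : {poly F}) 'X^2 m)`_0 != 0.
Proof.
rewrite -horner_coef0 /qpoch horner_prod big1 ?oner_neq0 // => i _.
by rewrite !hornerE /= expr0n /= mul0r addr0.
Qed.

(** The prefactor lowers the required precision by 2e, and the extra factors differ from 1 only from
    degree 2m+2 on. *)
Lemma eqmodX_qpoch_ext (F : fieldType) n e m m' :
  (n <= (e + m).*2.+2)%N -> (m <= m')%N ->
  eqmodX n ('X^(e.*2) * qpoch 'X^2 'X^2 m') ('X^(e.*2) * qpoch ('X^2 : {poly F}) 'X^2 m).
Proof.
move=> le_n le_m; apply: eqmodX_Xmul.
rewrite -(subnKC le_m) qpochD -exprM -exprD.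
by apply: eqmodX_qpoch; lia.
Qed.

(* Multiplied by [D = (q^2;q^2)_m (q^2;q^2)_(2r+1+m)], each term is exactly a
   term of [qvandermonde_limit] times two q-factorials, which may be replaced by
   [D] modulo the given power of ['X]; finally [D] is cancelled. *)
Lemma bailey_limit (F : fieldType) (ch2 : 2%N \in [pchar F]) r m :
  eqmodX (r + m).*2.+2
    (\sum_(i < m.+1) 'X^(((r + i) * (r + i).+1).*2) *
       (qpoch 'X^((r + i).*2.+2.*2) 'X^2 (m - i).*2 *
        qbinom 'X^2 (r + i).*2.+1 i))
    ('X^((r * r.+1).*2) : {poly F}).
Proof.
have ch2p : 2%N \in [pchar {poly F}] by rewrite pchar_poly.
pose P := qpoch ('X^2 : {poly F}) 'X^2; pose c := r.*2.+1.
have P0 k : P k != 0.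
  by apply: contraNneq (qpochX_coef0 F k) => e; rewrite -/(P k) e coef0.
have D0 : (P m * P (c + m)%N)`_0 != 0.
  by rewrite -horner_coef0 hornerM !horner_coef0 mulf_neq0 ?qpochX_coef0.
apply: (eqmodX_cancel D0); rewrite big_distrr /=.
pose Y i : {poly F} := qbinom 'X^2 m i * qpoch ('X^2 ^+ c * 'X^2 ^+ i.+1) 'X^2 (m - i).
have exact_term i : (i <= m)%N ->
  P m * P (c + m)%N * (qpoch 'X^((r + i).*2.+2.*2) 'X^2 (m - i).*2 *
        qbinom 'X^2 (r + i).*2.+1 i) = Y i * (P (m - i)%N * P (r + m).*2.+1).
  (* Multiplying by the denominators of both binomials lets the product formula apply without
     division. *)
  move=> le_im; apply: (mulIf (mulf_neq0 (P0 i) (P0 (c + i)%N))).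
  have e1 := qbinom_qpoch ('X^2 : {poly F}) ch2p (c + i) i.
  have e2 := qbinom_qpoch ('X^2 : {poly F}) ch2p (m - i) i.
  rewrite subnK // -/(P _) -/(P _) -/(P _) in e2.
  rewrite (_ : c + i + i = (r + i).*2.+1)%N -/(P _) -/(P _) -/(P _) in e1; last by lia.
  have e3 : P (r + m).*2.+1 = P (r + i).*2.+1 * qpoch 'X^((r + i).*2.+2.*2) 'X^2 (m - i).*2.
    rewrite /P (_ : (r + m).*2.+1 = (r + i).*2.+1 + (m - i).*2)%N; last by lia.
    rewrite qpochD -exprM -exprD; congr (_ * qpoch 'X^_ _ _); lia.
  have e4 : P (c + m)%N = P (c + i)%N * qpoch ('X^2 ^+ c * 'X^2 ^+ i.+1) 'X^2 (m - i).
    rewrite /P (_ : c + m = (c + i) + (m - i))%N; last by lia.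
    rewrite qpochD -!exprM -!exprD; congr (_ * qpoch 'X^_ _ _); lia.
  by rewrite e3 e4 -e1 -e2 /Y; ring.
apply: (@eqmodX_trans _ _ _ (\sum_(i < m.+1) Y i * ('X^(((r + i) * (r + i).+1).*2) * (P m * P (c + m)%N)))).
  apply: eqmodX_sum => -[i lt_i] /=.
  rewrite mulrCA exact_term // mulrCA; apply: eqmodX_mul2l.
  (* First [P (m - i)] is extended to [P m], which is precise enough because (r+i)(r+i+1) >= r+i;
     then [P (r + m).*2.+1] is exchanged for [P (c + m)]. *)
  apply: (@eqmodX_trans _ _ _ ('X^(((r + i) * (r + i).+1).*2) * (P m * P (r + m).*2.+1))).
    rewrite mulrA [X in eqmodX _ _ X]mulrA ![_ * P (r + m).*2.+1]mulrC.
    apply: eqmodX_mul2l; apply: eqmodX_sym; apply: eqmodX_qpoch_ext; nia.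
  rewrite ![P m * _]mulrC mulrA [X in eqmodX _ _ X]mulrA ![_ * P m]mulrC.
  apply: eqmodX_mul2l; apply: eqmodX_qpoch_ext; nia.
(* This is [qvandermonde_limit] in base X^2 with z = X^(2c), by (r+i)(r+i+1) = r(r+1) + ci + i^2. *)
rewrite (eq_bigr (fun i : 'I_m.+1 => (P m * P (c + m)%N * 'X^((r * r.+1).*2)) *
   (('X^2 ^+ c) ^+ i * 'X^2 ^+ (i * i) * qbinom 'X^2 m i *
   qpoch ('X^2 ^+ c * 'X^2 ^+ i.+1) 'X^2 (m - i)))); last first.
  move=> [i lt_i] _ /=.
  rewrite (_ : 'X^_ = 'X^((r * r.+1).*2) * ('X^2 ^+ c) ^+ i * 'X^2 ^+ (i * i)).
    by rewrite /Y; ring.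
  by rewrite -!exprM -!exprD; congr ('X^_); rewrite /c; nia.
by rewrite -big_distrr /= qvandermonde_limit // mulr1; apply: eqmodX_refl.
Qed.

(** After exchanging the sums, the inner sum for [r] is [bailey_limit] with m = n - r, so the
    precision 2n+2 is the same for all [r]. *)
Lemma rogers_selberg_mod2 (F : fieldType) (ch2 : 2%N \in [pchar F]) n :
  eqmodX n.*2.+2
    (\sum_(j < n.+1) 'X^((j * j.+1).*2) *
       ((\prod_(i < j.+1) (1 + 'X^(i.*2.+1))) *
        qpoch 'X^(j.*2.+2.*2) 'X^2 (n - j).*2))
    (\sum_(r < n.+1) ('X^(pent r%:Z) + 'X^(pent (Negz r))) * 'X^((r * r.+1).*2)
      : {poly F}).
Proof.
have ch2p : 2%N \in [pchar {poly F}] by rewrite pchar_poly.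
pose T (r j : nat) : {poly F} := ('X^(pent r%:Z) + 'X^(pent (Negz r))) *
  ('X^((j * j.+1).*2) * (qpoch 'X^(j.*2.+2.*2) 'X^2 (n - j).*2 *
        qbinom 'X^2 j.*2.+1 (j - r))).
rewrite (eq_bigr (fun j : 'I_n.+1 => \sum_(r < n.+1 | (r <= j)%N) T r j)); last first.
  move=> [j lt_j] _ /=; rewrite -pent_sumE // pent_sum_fold.
  apply: etrans (big_ord_widen n.+1 (fun r => T r j) lt_j); rewrite big_distrl big_distrr /=.
  by apply: eq_bigr => r _; rewrite /T; ring.
rewrite (exchange_big_dep xpredT) //=; apply: eqmodX_sum => -[r lt_r] /=.
rewrite -big_distrr /=; apply: eqmodX_mul2l.
have [m en] : exists m, n = (r + m)%N by exists (n - r)%N; lia.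
have := bailey_limit ch2 r m; rewrite -en.
rewrite -(big_geq_mkord _ _ xpredT (fun j => 'X^((j * j.+1).*2) *
  (qpoch 'X^(j.*2.+2.*2) 'X^2 (n - j).*2 * qbinom 'X^2 j.*2.+1 (j - r)))) /=.
rewrite -[X in index_iota X]add0n big_addn big_mkord.
rewrite (_ : n.+1 - r = m.+1)%N; last by lia.
congr eqmodX; apply: eq_bigr => i _; rewrite [(i + r)%N]addnC addKn.
by rewrite (_ : n - (r + i) = m - i)%N //; lia.
Qed.

(** * The parity of c6 *)

Lemma sum_mult_eq2 (R : comNzRingType) M (y : {poly R}) (P : pred nat) :
  (2 <= M)%N -> P =1 pred1 2%N -> \sum_(m < M.+1 | P m) y ^+ m = y ^+ 2.
Proof.
move=> M2 eP; rewrite (eq_bigl (fun m : 'I_M.+1 => m == inord 2)) ?big_pred1_eq ?inordK //.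
by move=> m; rewrite eP -val_eqE /= inordK.
Qed.

Lemma sum_mult_eq0 (R : comNzRingType) M (y : {poly R}) (P : pred nat) :
  P =1 pred1 0%N -> \sum_(m < M.+1 | P m) y ^+ m = 1.
Proof.
move=> eP; rewrite (eq_bigl (fun m : 'I_M.+1 => m == ord0)) ?big_pred1_eq //.
Qed.

Lemma sum_mult_le1 (R : comNzRingType) M (y : {poly R}) (P : pred nat) :
  (1 <= M)%N -> P =1 (fun m => m <= 1)%N -> \sum_(m < M.+1 | P m) y ^+ m = 1 + y.
Proof.
move=> M1 eP; rewrite big_mkcond big_ord_recl /= eP /= expr0; congr (_ + _).
case: M M1 => // M _; rewrite big_ord_recl /= eP /= expr1 big1 ?addr0 //.
by move=> i _; rewrite eP.
Qed.

Lemma big_ord_double (R : Type) (idx : R) (op : Monoid.com_law idx) m (f : nat -> R) :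
  \big[op/idx]_(i < m.*2) f i = op (\big[op/idx]_(i < m) f i.*2) (\big[op/idx]_(i < m) f i.*2.+1).
Proof.
rewrite -big_split; elim: m => [|m IH]; first by rewrite !big_ord0.
by rewrite doubleS !big_ord_recr /= IH Monoid.mulmA.
Qed.

Lemma coef_cond_j (F : fieldType) (ch2 : 2%N \in [pchar F]) n j : (j <= n)%N ->
  #|[set t : n.-tuple 'I_n.+1 | partition_tuple t && cond_j (parts_of t) j]|%:R =
  ('X^((j * j.+1).*2) * ((\prod_(i < j.+1) (1 + 'X^(i.*2.+1))) *
        qpoch 'X^(j.*2.+2.*2) 'X^2 (n - j).*2) : {poly F})`_n.
Proof.
move=> le_jn; have ch2p : 2%N \in [pchar {poly F}] by rewrite pchar_poly.
set M := n.*2.+1.*2.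
rewrite card_cond_j // card_partition_tuple -/M; last by rewrite /M; lia.
(* Precision [M.+1] is available because the geometric series of the part 2j+1 is cut after its
   [M]-th power. *)
rewrite -coef_mult_prod; apply: (@eqmodX_coef _ M.+1); first by rewrite /M; lia.
pose f x : {poly F} := \sum_(m < M.+1 | mult_ok j x.+1 m) 'X^(x.+1) ^+ m.
rewrite (eq_bigr (fun x : 'I_M => f x)); last first.
  by move=> x _; apply: eq_bigr => m _; rewrite exprM.
rewrite (big_ord_double _ _ f).
have M2 : (2 <= M)%N by rewrite /M.
have -> : \prod_(i < n.*2.+1) f i.*2.+1 = 'X^((j * j.+1).*2) *
    ((1 + 'X^(j.*2.+1)) ^+ 2 * qpoch 'X^(j.*2.+2.*2) 'X^2 (n - j).*2).
  (* Index [i] stands for the part 2i+2: the first j even parts occur twice, the next j, up to 4j,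
     are absent, and the others are distinct. *)
  have -> : (n.*2.+1 = j + (j + (n - j).*2.+1))%N by lia.
  rewrite big_split_ord big_split_ord /= [X in _ * (X * _)]big1 ?mul1r; last first.
    move=> [i lt_i] _ /=; apply: sum_mult_eq0 => m; rewrite /mult_ok.
    by rewrite /= odd_double /=; case: ifP; lia.
  congr (_ * _).
    rewrite (eq_bigr (fun i : 'I_j => 'X^(i.+1 * 4))); last first.
      move=> [i lt_i] _ /=; rewrite /f (@sum_mult_eq2 _ M _ (mult_ok j i.*2.+2)) // -?exprM; first by congr ('X^_); lia.
      move=> m; rewrite /mult_ok /= odd_double /=; case: ifP; lia.
    rewrite prodrXr; congr ('X^_).
    by elim: (j) => [|k IH]; rewrite ?big_ord0 // big_ord_recr /= IH; lia.
  rewrite (eq_bigr (fun i : 'I_(n - j).*2.+1 => 1 + 'X^(j.*2.*2.+2 + i.*2))); last first.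
    move=> [i lt_i] _ /=; rewrite /f (@sum_mult_le1 _ M _ (mult_ok j (j + (j + i)).*2.+2)) //; last first.
    - by move=> m; rewrite /mult_ok /= odd_double /=; case: ifP; lia.
    by congr (1 + 'X^_); lia.
  rewrite big_ord_recl /=; congr (_ * _).
    rewrite sqrrD expr1n mul1r mulr2n addrr_pchar2 // addr0 -exprM.
    by congr (1 + 'X^_); lia.
  apply: eq_bigr => i _; rewrite /bump /= -exprM -exprD.
  by congr (1 + 'X^_); lia.
have -> : \prod_(i < n.*2.+1) f i.*2 = (\prod_(i < j) (1 + 'X^(i.*2.+1))) *
    \sum_(m < M.+1) 'X^(j.*2.+1) ^+ m.
  (* Index [i] stands for the part 2i+1: the first j odd parts are distinct, 2j+1 is free, and
     larger ones are absent. *)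
  have -> : (n.*2.+1 = j.+1 + (n.*2 - j))%N by lia.
  rewrite big_split_ord big_ord_recr /= -mulrA; congr (_ * _).
    apply: eq_bigr => -[i lt_i] _ /=; apply: sum_mult_le1 => // m.
    by rewrite /mult_ok /= odd_double /=; lia.
  rewrite [X in _ * X]big1 ?mulr1; last first.
    move=> [i lt_i] _ /=; apply: sum_mult_eq0 => m.
    rewrite /mult_ok /= odd_double /=; lia.
  by apply: eq_bigl => m; rewrite /mult_ok /= odd_double /=; lia.
(* In characteristic 2 the factor 1 + q^(4j+2) of the even parts is the square
   of 1 + q^(2j+1); one copy cancels the geometric series of the part 2j+1. *)
rewrite [X in eqmodX _ _ X](_ : _ = ('X^((j * j.+1).*2) * ((\prod_(i < j.+1) (1 + 'X^(i.*2.+1))) *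
        qpoch 'X^(j.*2.+2.*2) 'X^2 (n - j).*2)) * 1); last by rewrite mulr1.
rewrite [\prod_(i < j.+1) _]big_ord_recr /=.
set g := \sum_(m < _) _; set y := 'X^(j.*2.+1); set p := \prod_(i < j) _.
set z := 'X^((j * j.+1).*2); set w := qpoch _ _ _.
rewrite [X in eqmodX _ X](_ : _ = (z * (p * (1 + y) * w)) * ((1 + y) * g)); last by ring.
apply: eqmodX_mul2l.
have -> : (1 + y) * g = 1 + y ^+ M.+1.
  rewrite addrC -[1 in LHS](oppr_pchar2 ch2p) -subrX1 oppr_pchar2 // addrC //.
rewrite /eqmodX addrAC subrr add0r -exprM dvdp_exp2l //; lia.
Qed.

(** The difference of the two values is (j-k)(7(j+k)+5), whose second factor is nonzero modulo 7. *)
Lemma pent7_inj (n : nat) (j k : int) :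
  2 * n%:Z = 7 * j ^+ 2 + 5 * j -> 2 * n%:Z = 7 * k ^+ 2 + 5 * k -> j = k.
Proof.
move=> -> e; have /eqP : (j - k) * (7 * (j + k) + 5) = 0.
  by rewrite -[RHS](subrr (7 * k ^+ 2 + 5 * k)) -{1}e; ring.
by rewrite mulf_eq0 => /orP [/eqP|/eqP]; lia.
Qed.

(** Since s(s+1) is invariant under s -> -1-s, both exponents have the form s(3s+1)/2 + 2s(s+1) =
    (7s^2+5s)/2, with s = r or s = -1-r. *)
Lemma c6_mod2 n : (c6 n)%:R = \sum_(r < n.+1)
  ((2 * n%:Z == 7 * r%:Z ^+ 2 + 5 * r%:Z)%:R +
   (2 * n%:Z == 7 * (Negz r) ^+ 2 + 5 * (Negz r))%:R) :> 'F_2.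
Proof.
have ch2 : 2%N \in [pchar 'F_2] by rewrite pchar_Fp.
have pent7 r e : ((n == pent r + e)%N = (2 * n%:Z == r * (3 * r + 1) + (2 * e)%:Z)).
  by have := pentE r; lia.
rewrite c6E natr_sum (eq_bigr _ (fun (j : 'I_n.+1) _ => @coef_cond_j _ ch2 n j (ltn_ord j))).
rewrite -coef_sum (eqmodX_coef _ (rogers_selberg_mod2 ch2 n)); last by lia.
rewrite coef_sum; apply: eq_bigr => -[r lt_r] _ /=.
rewrite mulrDl -!exprD coefD !coefXn !pent7.
by congr (_%:R + _%:R); congr nat_of_bool; congr (_ == _); rewrite ?NegzE; lia.
Qed.

Theorem theorem7 (n : nat) :
  odd (c6 n) <-> exists j : int, (2 * n%:Z = 7 * j ^+ 2 + 5 * j)%R.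
Proof.
have -> : odd (c6 n) = ((c6 n)%:R != 0 :> 'F_2).
  by rewrite -(dvdn_pcharf (pchar_Fp (isT : prime 2))) dvdn2 negbK.
rewrite c6_mod2; split=> [|[j ej]].
  case: (boolP [exists r : 'I_n.+1, (2 * n%:Z == 7 * r%:Z ^+ 2 + 5 * r%:Z) ||
    (2 * n%:Z == 7 * (Negz r) ^+ 2 + 5 * (Negz r))]) => [/existsP [r /orP]|no_j].
    by case=> /eqP e _; eexists; exact: e.
  rewrite big1 ?eqxx // => r _; move: no_j; rewrite negb_exists => /forallP /(_ r).
  by rewrite negb_or => /andP [/negbTE -> /negbTE ->]; rewrite addr0.
(* As the solution is unique, exactly one term of the sum is 1. *)
have B k : (2 * n%:Z == 7 * k ^+ 2 + 5 * k) = (k == j).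
  by apply/eqP/eqP => [e|->]; [exact: pent7_inj e ej | exact: ej].
under eq_bigr => r _ do rewrite !B.
(* The solution lies in the range of summation because (7j^2+5j)/2 is at least [r] in both cases. *)
have [r [lt_r er]] : exists r : nat, (r < n.+1)%N /\ (j = r%:Z \/ j = Negz r).
  case: j ej {B} => r ej; exists r; split; auto; nia.
rewrite (bigD1 (Ordinal lt_r)) //= big1 ?addr0 => [|i ne].
  by case: er => ->; rewrite eqxx.
have ne_ir : nat_of_ord i <> r by move=> e; case/eqP: ne; apply: val_inj.
by case: er => ->; do 2![case: eqP => [[]|_] //]; rewrite addr0.
Qed.
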